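(* Let $p>2$ be a prime, and let $F$, $K$, $a$, $\xi_p$, $G=\langle\sigma\rangle$, $J$ and $N$ be as in the context. Then, as an $\mathbb{F}_p[G]$-module, $J$ decomposes as an internal direct sum $$J = X\oplus Y\oplus Z,$$ where (1) $X$ is an indecomposable $\mathbb{F}_p[G]$-submodule, of $\mathbb{F}_p$-dimension $1$ if $\xi_p\in N(K^\times)$ and of dimension $2$ if $\xi_p\notin N(K^\times)$; (2) $Y$ is a free $\mathbb{F}_p[G]$-submodule with $Y^G=N(J)$; (3) $Z$ is a trivial $\mathbb{F}_p[G]$-module (i.e. $G$ acts trivially on $Z$). Moreover, the rank of any maximal free $\mathbb{F}_p[G]$-submodule of $J$ equals $\dim_{\mathbb{F}_p} N(J)$.
   Context: Let $p$ be a prime and $F$ a field of characteristic different from $p$ containing a primitive $p$th root of unity $\xi_p$. Let $a\in F^\times\setminus F^{\times p}$ and $K=F(\sqrt[p]{a})$, a cyclic extension of degree $p$; $K^\times=K\setminus\{0\}$. Let $G=\mathrm{Gal}(K/F)=\langle\sigma\rangle$, where $\sigma(\sqrt[p]{a})/\sqrt[p]{a}=\xi_p$. Let $J=K^\times/K^{\times p}$, an $\mathbb{F}_p[G]$-module (written multiplicatively or additively; elements denoted $[\gamma]$, $\gamma\in K^\times$). For a $G$-module $V$, $V^G$ denotes the submodule of $G$-fixed elements. Let $N=1+\sigma+\dots+\sigma^{p-1}\in\mathbb{F}_p[G]$, also viewed as the endomorphism of $J$ it induces; $N(J)$ is its image. $N(K^\times)\subseteq F^\times$ denotes the group of norms from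 $K$ to $F$. *)

(* Defs.v *)
From HB Require Import structures.
From mathcomp Require Import all_boot all_order all_algebra all_field.
Set Implicit Arguments. Unset Strict Implicit. Unset Printing Implicit Defensive.
Import GRing.Theory.
Local Open Scope ring_scope.

(* Generic notions for a module V over a ring R, with an endomorphism s
   (the action of the generator sigma of the cyclic group G of order n).
   Subsets of V are predicates V -> Prop (V may be infinite dimensional). *)
Section ModuleNotions.
Variables (R : nzRingType) (V : lmodType R).

Definition submod (s : V -> V) (X : V -> Prop) : Prop :=
  [/\ X 0, (forall x y, X x -> X y -> X (x + y)),
      (forall (c : R) x, X x -> X (c *: x)) & (forall x, X x -> X (s x))].

Definition comb (vs : seq V) (c : nat -> R) : V :=
  \sum_(k < size vs) c k *: vs`_k.

Definition is_basis (X C : V -> Prop) : Prop :=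
  [/\ (forall v, C v -> X v),
      (forall (vs : seq V) (c : nat -> R), uniq vs -> (forall v, v \in vs -> C v) ->
          comb vs c = 0 -> forall k, (k < size vs)%N -> c k = 0)
    & (forall y, X y -> exists (vs : seq V) (c : nat -> R),
          (forall v, v \in vs -> C v) /\ y = comb vs c)].

Definition dim_eq (X : V -> Prop) (d : nat) : Prop :=
  exists vs : seq V, [/\ uniq vs, size vs = d & is_basis X (fun v => v \in vs)].

(* finite R[G]-linear combination, G = <s> cyclic of order n:
   sum_k (sum_{i<n} c k i s^i) (vs_k) *)
Definition gcomb (n : nat) (s : V -> V) (vs : seq V) (c : nat -> nat -> R) : V :=
  \sum_(k < size vs) \sum_(i < n) c k i *: iter i s vs`_k.

Definition free_basis (n : nat) (s : V -> V) (Y B : V -> Prop) : Prop :=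
  [/\ (forall b, B b -> Y b),
      (forall (vs : seq V) (c : nat -> nat -> R), uniq vs ->
          (forall v, v \in vs -> B v) -> gcomb n s vs c = 0 ->
          forall k i, (k < size vs)%N -> (i < n)%N -> c k i = 0)
    & (forall y, Y y -> exists (vs : seq V) (c : nat -> nat -> R),
          (forall v, v \in vs -> B v) /\ y = gcomb n s vs c)].

Definition free_submod (n : nat) (s : V -> V) (Y : V -> Prop) : Prop :=
  submod s Y /\ exists B, free_basis n s Y B.

Definition maximal_free_submod (n : nat) (s : V -> V) (Y : V -> Prop) : Prop :=
  free_submod n s Y /\
  forall W, free_submod n s W -> (forall y, Y y -> W y) -> forall w, W w -> Y w.

Definition dsum3 (X Y Z : V -> Prop) : Prop :=
  (forall j, exists x y z, [/\ X x, Y y, Z z & j = x + y + z]) /\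
  (forall x y z, X x -> Y y -> Z z -> x + y + z = 0 -> [/\ x = 0, y = 0 & z = 0]).

Definition indecomposable (s : V -> V) (X : V -> Prop) : Prop :=
  [/\ submod s X, (exists x, X x /\ x != 0) &
      forall A B, submod s A -> submod s B ->
        (forall x, X x <-> exists a b, [/\ A a, B b & x = a + b]) ->
        (forall a b, A a -> B b -> a + b = 0 -> a = 0) ->
        (forall a, A a -> a = 0) \/ (forall b, B b -> b = 0)].

Definition trivial_submod (s : V -> V) (Z : V -> Prop) : Prop :=
  submod s Z /\ forall z, Z z -> s z = z.

Definition normop (n : nat) (s : V -> V) (j : V) : V := \sum_(i < n) iter i s j.
Definition normimage (n : nat) (s : V -> V) (y : V) : Prop := exists j, y = normop n s j.

Definition same_card (B C : V -> Prop) : Prop :=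
  exists f : V -> V, [/\ (forall b, B b -> C (f b)),
    (forall b1 b2, B b1 -> B b2 -> f b1 = f b2 -> b1 = b2) &
    (forall c, C c -> exists b, B b /\ f b = c)].

End ModuleNotions.

(* Main.v *)
Require Import Defs.
From HB Require Import structures.
From mathcomp Require Import all_boot all_order all_algebra all_field.
From mathcomp Require Import boolp classical_sets functions cardinality.
Set Implicit Arguments. Unset Strict Implicit. Unset Printing Implicit Defensive.
Import GRing.Theory.
Local Open Scope ring_scope.
Local Open Scope classical_set_scope.

(** Put tau = sigma - 1, so that N = tau^(p-1) and tau^p = 0 on J.  If the norm
    of [gamma] vanishes in J, then it is a pth power lying in F, hence the norm
    of some alpha^t f with f in F, and Hilbert 90 gives
      [gamma] = t [alpha] + [f] + tau [omega].
    When gamma has length l with 2 < l < p, omega has length l + 1 and the same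
    socle; climbing up to length p puts tau^(l-1) [gamma] in N(J).  For l = 2
    only an error term in <[xi]> = <tau [alpha]> can occur.  So outside of N(J)
    the intersection of Ker tau and Im tau is controlled by [xi], which lies in
    N(J) exactly when xi is a norm.  Y is generated by lifts along N of a basis
    of N(J), X is <[alpha], [xi]> if xi is not a norm, and otherwise the line
    of a fixed class [delta] with sigma delta / delta = k^p, N k = xi; finally Z
    is a complement in Ker tau of its intersection with X + Y. *)

(** * Linear algebra in arbitrary dimension: spans, complements, cardinality of bases *)

Section LinearAlgebra.
Variables (R : fieldType) (V : lmodType R).
Implicit Types (A B C S T : set V) (x y v : V).

Definition subspace A : Prop :=
  [/\ A 0, forall x y, A x -> A y -> A (x + y) & forall (c : R) x, A x -> A (c *: x)].

Lemma subspaceB A x y : subspace A -> A x -> A y -> A (x - y).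
Proof. by case=> _ AD AZ Ax Ay; rewrite -scaleN1r; apply/AD/AZ. Qed.

Lemma subspace_sum A (I : Type) (r : seq I) (P : pred I) (f : I -> V) :
  subspace A -> (forall i, P i -> A (f i)) -> A (\sum_(i <- r | P i) f i).
Proof. by case=> A0 AD _ Af; elim/big_ind: _. Qed.

Lemma subspace_unscale A (c : R) x : subspace A -> c != 0 -> A (c *: x) -> A x.
Proof. by case=> _ _ AZ c0 /(AZ c^-1); rewrite scalerA mulVf // scale1r. Qed.

(** Impredicative, so that membership is handled through minimality; finite combinations are
    recovered by [lspan_image_combination]. *)
Definition lspan S : set V := [set x | forall A, subspace A -> S `<=` A -> A x].

Lemma subspace_lspan S : subspace (lspan S).
Proof.
split=> [A [] // | x y Sx Sy A sA SA | c x Sx A sA SA].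
  by have [_ AD _] := sA; apply: AD; [apply: Sx | apply: Sy].
by have [_ _ AZ] := sA; apply: AZ; apply: Sx.
Qed.

Lemma sub_lspan S : S `<=` lspan S.
Proof. by move=> x Sx A _; apply. Qed.

Lemma lspan_min S (A : V -> Prop) : subspace A -> (forall x, S x -> A x) ->
  forall x, lspan S x -> A x.
Proof. by move=> sA SA x; apply. Qed.

Lemma lspan_mono S T : S `<=` T -> lspan S `<=` lspan T.
Proof. by move=> ST; apply: lspan_min (subspace_lspan T) _ => x /ST /sub_lspan. Qed.

Lemma lspan_add_elem S c x :
  lspan (S `|` [set c]) x -> exists (k : R) y, lspan S y /\ x = y + k *: c.
Proof.
have [S0 SD SZ] := subspace_lspan S; move: x; apply: lspan_min; first split.
- by exists 0, 0; rewrite scale0r addr0.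
- move=> _ _ [k [y [Sy ->]]] [k' [y' [Sy' ->]]].
  by exists (k + k'), (y + y'); split; [apply: SD | rewrite addrACA scalerDl].
- move=> d _ [k [y [Sy ->]]].
  by exists (d * k), (d *: y); split; [apply: SZ | rewrite scalerDr scalerA].
move=> y [Sy | ->].
  by exists 0, y; rewrite scale0r addr0; split=> //; apply: sub_lspan.
by exists 1, 0; rewrite scale1r add0r.
Qed.

Lemma lspan_image_combination (h : V -> V) S x : lspan (h @` S) x ->
  exists (vs : seq V) (d : V -> R), [/\ uniq vs, forall v, v \in vs -> S v &
    x = \sum_(v <- vs) d v *: h v].
Proof.
(* The coefficients must vanish off [vs], so that two combinations can be rewritten over one common
   list and added there. *)
pose Q x := exists (vs : seq V) (d : V -> R), [/\ uniq vs,
  forall v, v \in vs -> S v, forall v, v \notin vs -> d v = 0 &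
  x = \sum_(v <- vs) d v *: h v].
have widen vs ws (d : V -> R) : uniq vs -> uniq ws -> {subset vs <= ws} ->
    (forall v, v \notin vs -> d v = 0) ->
    \sum_(v <- vs) d v *: h v = \sum_(v <- ws) d v *: h v.
  move=> Uv Uw sub d0; rewrite [RHS](bigID (mem vs)) /= [X in _ + X]big1.
    rewrite addr0 -[RHS]big_filter; apply: perm_big; apply: uniq_perm => //.
      exact: filter_uniq.
    by move=> v; rewrite mem_filter; case: (boolP (v \in vs)) => // /sub ->.
  by move=> v /d0->; rewrite scale0r.
suff Qx : lspan (h @` S) x -> Q x by case/Qx=> vs [d [? ? _ ?]]; exists vs, d.
move: x; apply: lspan_min; first split.
- by exists [::], (fun=> 0); split=> //; rewrite big_nil.
- move=> _ _ [v1 [d1 [U1 S1 z1 ->]]] [v2 [d2 [U2 S2 z2 ->]]].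
  pose ws := undup (v1 ++ v2).
  exists ws, (fun v => d1 v + d2 v); split; first exact: undup_uniq.
  + by move=> v; rewrite mem_undup mem_cat => /orP[/S1|/S2].
  + move=> v; rewrite mem_undup mem_cat negb_or => /andP[n1 n2].
    by rewrite z1 // z2 // addr0.
  rewrite (widen v1 ws) ?undup_uniq // => [|v v1v]; last first.
    by rewrite mem_undup mem_cat v1v.
  rewrite (widen v2 ws) ?undup_uniq // => [|v v1v]; last first.
    by rewrite mem_undup mem_cat v1v orbT.
  by rewrite -big_split; apply: eq_bigr => v _; rewrite scalerDl.
- move=> c _ [vs [d [U S1 z ->]]].
  exists vs, (fun v => c * d v); split=> // [v /z->|]; first by rewrite mulr0.
  by rewrite scaler_sumr; apply: eq_bigr => v _; rewrite scalerA.
move=> _ [v Sv <-]; exists [:: v], (fun w => (w == v)%:R); split=> //.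
- by move=> w; rewrite inE => /eqP->.
- by move=> w; rewrite inE => /negbTE->.
by rewrite big_seq1 eqxx scale1r.
Qed.

(** Directedness makes the union of the spans a subspace, which then contains the span of the
    union. *)
Lemma lspan_directed_bigcup (I : Type) (D : set I) (S : I -> set V) x :
  D !=set0 ->
  (forall i j, D i -> D j -> exists k, [/\ D k, S i `<=` S k & S j `<=` S k]) ->
  lspan (\bigcup_(i in D) S i) x -> exists i, D i /\ lspan (S i) x.
Proof.
move=> [i0 Di0] dir; move: x; apply: lspan_min; first split.
- by exists i0; split=> //; case: (subspace_lspan (S i0)).
- move=> y z [i [Di Sy]] [j [Dj Sz]]; have [k [Dk ik jk]] := dir i j Di Dj.
  exists k; split=> //; have [_ SD _] := subspace_lspan (S k).
  by apply: SD; [apply: lspan_mono ik _ _ | apply: lspan_mono jk _ _].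
- move=> c y [i [Di Sy]]; exists i; split=> //.
  by have [_ _ SZ] := subspace_lspan (S i); apply: SZ.
by move=> y [i Di Sy]; exists i; split=> //; apply: sub_lspan.
Qed.

Definition independent S : Prop := forall v, S v -> ~ lspan (S `\ v) v.

Lemma independent_sub S T : S `<=` T -> independent T -> independent S.
Proof.
move=> ST iT v Sv sv; apply: (iT v (ST v Sv)).
by apply: (lspan_mono _ sv) => w [/ST].
Qed.

Lemma independent_add S c : independent S -> ~ lspan S c ->
  independent (S `|` [set c]).
Proof.
move=> iS ncS v [Sv | ->]; last first.
  by move=> H; apply: ncS; apply: (lspan_mono _ H) => w [[]].
move=> H.
have vc : v <> c by move=> e; apply: ncS; rewrite -e; apply: sub_lspan.
have : lspan ((S `\ v) `|` [set c]) v.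
  by apply: (lspan_mono _ H) => w [[Sw|->] wv]; [left | right].
case/lspan_add_elem=> k [y [Sy e]].
have [k0|k0] := eqVneq k 0.
  by apply: (iS v Sv); rewrite {2}e k0 scale0r addr0.
apply: ncS; apply: (subspace_unscale (subspace_lspan S) k0 _).
have -> : k *: c = v - y by rewrite {1}e addrC addKr.
apply: (subspaceB (subspace_lspan S) (sub_lspan Sv) _).
by apply: (lspan_mono _ Sy) => w [].
Qed.

Lemma independent_directed_bigcup (I : Type) (D : set I) (S : I -> set V) :
  (forall i j, D i -> D j -> exists k, [/\ D k, S i `<=` S k & S j `<=` S k]) ->
  (forall i, D i -> independent (S i)) -> independent (\bigcup_(i in D) S i).
Proof.
move=> dir iS v [i Di Siv] H.
have : lspan (\bigcup_(j in D) (S j `\ v)) v.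
  apply: (lspan_mono _ H) => w [[j Dj Sjw] wv]; by exists j.
move=> /lspan_directed_bigcup[||j [Dj H']]; first by exists i.
  move=> j l Dj Dl; have [k [Dk jk lk]] := dir j l Dj Dl.
  by exists k; split=> // w [h n]; split=> //; [apply: jk | apply: lk].
have [k [Dk ik jk]] := dir i j Di Dj.
apply: (iS k Dk v (ik v Siv)).
by apply: (lspan_mono _ H') => w [/jk].
Qed.

Lemma exists_independent_spanning S :
  exists D, [/\ D `<=` S, independent D & S `<=` lspan D].
Proof.
have [|D [[DS iD] maxD]] :=
  @Zorn_bigcup V [set D | D `<=` S /\ independent D].
  move=> F FP totF; split; first by move=> v [A /FP[AS _]] /AS.
  apply: independent_directed_bigcup => [A B FA FB | A /FP[] //].
  by case: (totF A B FA FB) => sub; [exists B | exists A]; split.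
exists D; split=> // x Sx; apply: contrapT => nx.
apply: (maxD (D `|` [set x])).
  split; first by move=> v; left.
  by move=> H; apply: nx; apply: sub_lspan (H _ _); right.
by split; [move=> v [/DS | ->] | apply: independent_add].
Qed.

Lemma exists_complement (A D : set V) : subspace A -> subspace D -> D `<=` A ->
  exists Z, [/\ subspace Z, Z `<=` A, forall z, Z z -> D z -> z = 0 &
    forall x, A x -> exists d z, [/\ D d, Z z & x = d + z]].
Proof.
move=> sA sD DA; have [A0 AD AZ] := sA; have [D0 DD DZ] := sD.
(* [P] leaves out [Z 0], because the empty chain has empty union; maximality restores it by
   comparison with [[set 0]]. *)
pose P Z := [/\ forall x y, Z x -> Z y -> Z (x + y),
  forall (c : R) x, Z x -> Z (c *: x), Z `<=` A & forall z, Z z -> D z -> z = 0].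
have [|Z [PZ maxZ]] := @Zorn_bigcup V P.
  move=> F FP totF; split.
  - move=> x y [B FB Bx] [C FC Cy].
    case: (totF B C FB FC) => sub; [exists C | exists B] => //.
      by have [a _ _ _] := FP C FC; apply: a => //; apply: sub.
    by have [a _ _ _] := FP B FB; apply: a => //; apply: sub.
  - by move=> c x [B FB Bx]; exists B => //; have [_ a _ _] := FP B FB; apply: a.
  - by move=> x [B FB Bx]; have [_ _ a _] := FP B FB; apply: a.
  - by move=> x [B FB Bx]; have [_ _ _ a] := FP B FB; apply: a.
have [ZD ZZ ZA ZD0] := PZ.
have Z0 : Z 0.
  have [[z Zz]|nZ] := pselect (exists z, Z z).
    by rewrite -(scale0r z); apply: ZZ.
  exfalso; apply: (maxZ [set 0]); first split.
  - by move=> z Zz; case: nZ; exists z.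
  - by move=> H; apply: nZ; exists 0; apply: H.
  by split=> [x y -> -> | c x -> | x -> | z ->] //; rewrite ?addr0 ?scaler0.
have sZ : subspace Z by [].
exists Z; split=> // x Ax; apply: contrapT => nx.
(* If [x] is not in [D + Z], then [Z + <x>] still meets [D] trivially: an element of [D] with
   [c != 0] could be solved for [x]. *)
pose Z' y := exists z (c : R), Z z /\ y = z + c *: x.
apply: (maxZ Z'); first split.
- by move=> z Zz; exists z, 0; rewrite scale0r addr0.
- move=> H; apply: nx; exists 0, x; rewrite add0r; split=> //.
  by apply: H; exists 0, 1; rewrite add0r scale1r.
split.
- move=> _ _ [z [c [Zz ->]]] [z' [c' [Zz' ->]]].
  by exists (z + z'), (c + c'); rewrite addrACA scalerDl; split; first exact: ZD.
- move=> d _ [z [c [Zz ->]]].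
  by exists (d *: z), (d * c); rewrite scalerDr scalerA; split; first exact: ZZ.
- by move=> _ [z [c [Zz ->]]]; apply: AD (AZ _ _ _) => //; apply: ZA.
move=> _ [z [c [Zz ->]]] Dz; have [c0|c0] := eqVneq c 0.
  by move: Dz; rewrite c0 scale0r addr0; apply: ZD0.
case: nx; exists (c^-1 *: (z + c *: x)), (- (c^-1) *: z); split.
- exact: DZ.
- exact: ZZ.
by rewrite scalerDr scalerA mulVf // scale1r scaleNr addrC addKr.
Qed.

(* Zorn's lemma on partial injections [G] from [B] to [C] along which replacing
   the elements of [B] by their images keeps [B] independent. *)
Lemma steinitz_injection B C : independent B -> B `<=` lspan C ->
  exists f : V -> V, (forall b, B b -> C (f b)) /\
    (forall b b', B b -> B b' -> f b = f b' -> b = b').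
Proof.
move=> iB BC.
pose dom (G : set (V * V)) b := exists c, G (b, c).
pose im (G : set (V * V)) c := exists b, G (b, c).
pose mixed G := im G `|` (B `\` dom G).
(* The fourth clause keeps the images disjoint from the elements of [B] not yet replaced. *)
pose P (G : set (V * V)) := [/\ forall b c, G (b, c) -> B b /\ C c,
  forall b c c', G (b, c) -> G (b, c') -> c = c',
  forall b b' c, G (b, c) -> G (b', c) -> b = b',
  forall c, im G c -> B c -> dom G c & independent (mixed G)].
have [|G [[GBC Gfun Ginj Gdisj iG] maxG]] := @Zorn_bigcup (V * V)%type P.
  move=> F FP totF.
  have common g g' : (\bigcup_(X in F) X) g -> (\bigcup_(X in F) X) g' ->
      exists G, [/\ F G, G g & G g'].
    move=> [G FG Gg] [G' FG' Gg'].
    by case: (totF G G' FG FG') => sub; [exists G' | exists G];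
      split=> //; apply: sub.
  split.
  - by move=> b c [G /FP[a _ _ _ _]] /a.
  - by move=> b c c' g /(common _ _ g)[G [/FP[_ a _ _ _] h h']]; apply: a h h'.
  - by move=> b b' c g /(common _ _ g)[G [/FP[_ _ a _ _] h h']]; apply: a h h'.
  - move=> c [b [G FG Gbc]] Bc; have [_ _ _ a _] := FP G FG.
    by have [|c' ?] := a c _ Bc; [exists b | exists c', G].
  have [[G0 FG0]|F0] := pselect (exists G, F G); last first.
    apply: independent_sub iB => c [[b [G FG]] | [] //].
    by case: F0; exists G.
  (* Removing the final domain [U] from [B] makes these sets increase along the chain; each lies in
     [mixed G], hence is independent. *)
  pose U := dom (\bigcup_(X in F) X).
  apply: (@independent_sub _ (\bigcup_(G in F) (im G `|` (B `\` U)))).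
    move=> c [[b [G FG Gbc]] | BUc]; last by exists G0 => //; right.
    by exists G => //; left; exists b.
  apply: independent_directed_bigcup => [G H FG FH|G FG].
    have mono X Y : X `<=` Y -> im X `|` (B `\` U) `<=` im Y `|` (B `\` U).
      by move=> XY c [[b /XY h]|h]; [left; exists b | right].
    by case: (totF G H FG FH) => /mono sub; [exists H | exists G]; split.
  have [_ _ _ _] := FP G FG; apply: independent_sub => c [h | [Bc nU]].
    by left.
  by right; split=> // -[d Gd]; apply: nU; exists d, G.
have domG b : B b -> dom G b.
  move=> Bb; apply: contrapT => nb.
  have Mb : mixed G b by right.
  (* Otherwise the span of [mixed G] without [b] would contain [C], hence [b], against
     independence. *)
  have [c [Cc nc]] : exists c, C c /\ ~ lspan (mixed G `\ b) c.
    apply: contrapT => nex; apply: (iG b Mb).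
    apply: lspan_min (BC b Bb); first exact: subspace_lspan.
    by move=> c Cc; apply: contrapT => nc; apply: nex; exists c.
  have nimb : ~ im G b by move=> h; apply: nb; apply: Gdisj.
  have nimc : ~ im G c.
    move=> h; apply: nc; apply: sub_lspan; split; first by left.
    by move=> e; apply: nimb; rewrite -e.
  apply: (maxG (G `|` [set (b, c)])).
    split; first by move=> g; left.
    by move=> sub; apply: nb; exists c; apply: sub; right.
  have dG x y : G (x, y) -> x <> b by move=> h e; apply: nb; exists y; rewrite -e.
  split.
  - by move=> x y [/GBC // | [-> ->]].
  - move=> x y y' [h|[-> ->]] [h'|[]] //; first exact: Gfun h h'.
      by move=> e _; case: (dG _ _ h).
    by case: (dG _ _ h').
  - move=> x x' y [h|[-> ->]] [h'|[]] //; first exact: Ginj h h'.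
      by move=> _ e; case: nimc; exists x; rewrite -e.
    by case: nimc; exists x'.
  - move=> y [x [h|[_ ->]]] By.
      by have [|z hz] := Gdisj y _ By; [exists x | exists z; left].
    have [e|cb] := pselect (c = b); first by exists b; right; rewrite e.
    apply: contrapT => nd; apply: nc; apply: sub_lspan; split=> //.
    by right; split=> // -[z hz]; apply: nd; exists z; left.
  apply: independent_sub (independent_add (independent_sub _ iG) nc) => [y|y []//].
  case=> [[x [h|[_ ->]]] | [By nd]]; [left | by right | left].
    split; first by left; exists x.
    by move=> e; apply: nimb; exists x; rewrite -e.
  split; first by right; split=> // -[z hz]; apply: nd; exists z; left.
  by move=> e; apply: nd; exists c; right; rewrite e.
have /choice[f fP] b : exists c, B b -> G (b, c).
  have [/domG[c h]|nb] := pselect (B b); first by exists c.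
  by exists 0.
exists f; split=> [b /fP/GBC[]//|b b' /fP h /fP h' e].
by apply: Ginj h _; rewrite e.
Qed.

(** Steinitz exchange gives injections both ways, and Cantor-Bernstein turns them into a
    bijection. *)
Lemma independent_same_card B C : independent B -> independent C ->
  B `<=` lspan C -> C `<=` lspan B -> same_card B C.
Proof.
move=> iB iC BC CB.
pose pV : pointedType := HB.pack V (isPointed.Build V 0).
have le S T : independent S -> S `<=` lspan T -> (S #<= (T : set pV))%card.
  move=> iS ST; have [f [fT finj]] := steinitz_injection iS ST.
  have /injfunPex[g] : exists2 f : V -> V, set_fun S T f & set_inj S f.
    by exists f => // x y /set_mem Sx /set_mem Sy; apply: finj.
  exact: inj_card_le g.
have /card_set_bijP[f [fun_f inj_f surj_f]] : (B #= (C : set pV))%card.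
  by apply: Cantor_Bernstein; apply: le.
exists f; split=> [b /fun_f // | b b' Bb Bb' | c /surj_f[b Bb <-]].
  by apply: inj_f; apply/mem_set.
by exists b.
Qed.

Lemma is_basis_lspan (X C : set V) : subspace X -> is_basis X C ->
  [/\ independent C, X `<=` lspan C & C `<=` X].
Proof.
move=> sX [CX Cind Cgen]; split=> // [v Cv H | x /Cgen[vs [c [vsC ->]]]]; last first.
  apply: subspace_sum => [|i _]; first exact: subspace_lspan.
  have [_ _ SZ] := subspace_lspan C; apply: SZ; apply: sub_lspan; apply: vsC.
  exact: mem_nth.
have : lspan (id @` (C `\ v)) v by rewrite image_id.
case/lspan_image_combination=> vs [d [Uvs vsC e]].
have := Cind (v :: vs) (fun k => if k is k'.+1 then d vs`_k' else -1) _ _ _ 0%N isT.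
rewrite /= Uvs andbT => H1; move/eqP: (oner_neq0 R); apply.
apply: oppr_inj; rewrite oppr0; apply: H1.
- by apply/negP => /vsC[_]; apply.
- by move=> w; rewrite inE => /orP[/eqP->//|/vsC[]].
rewrite /comb big_ord_recl /= scaleN1r {1}e (big_nth 0) big_mkord addNr //.
Qed.

(** A nonzero coefficient would express one vector of the image through the others, which differ
    from it since [h] is injective on [B]. *)
Lemma independent_coef (h : V -> V) B (vs : seq V) (d : nat -> R) :
  (forall b b', B b -> B b' -> h b = h b' -> b = b') -> independent (h @` B) ->
  uniq vs -> (forall v, v \in vs -> B v) ->
  \sum_(k < size vs) d k *: h vs`_k = 0 -> forall k, (k < size vs)%N -> d k = 0.
Proof.
move=> hinj hind Uvs vB e k klt; have [//|dk] := eqVneq (d k) 0.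
have Bk : B vs`_k by apply: vB; apply: mem_nth.
exfalso; apply: (hind (h vs`_k)); first by exists vs`_k.
set S := (_ `\ _); have sS := subspace_lspan S.
apply: (subspace_unscale sS dk _).
move: e; rewrite (bigD1 (Ordinal klt)) //= => /eqP; rewrite addr_eq0 => /eqP->.
have [_ _ SZ] := sS; rewrite -scaleN1r; apply: (SZ).
apply: subspace_sum => // i ik; apply: (SZ); apply: sub_lspan.
have Bi : B vs`_i by apply: vB; apply: mem_nth.
split; first by exists vs`_i.
move=> /(hinj _ _ Bi Bk)/eqP; rewrite nth_uniq // => /eqP ei.
by case/eqP: ik; apply: val_inj.
Qed.

Lemma independent_set1 v : v != 0 -> independent [set v].
Proof.
move=> v0 _ -> H; move/eqP: v0; apply.
apply: (H [set 0]); last by move=> w [].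
by split=> [|x y -> ->|c x ->] //=; rewrite ?addr0 ?scaler0.
Qed.

Lemma is_basis_seq (X : set V) (ws : seq V) : (forall v, v \in ws -> X v) ->
  independent [set v | v \in ws] -> (forall x, X x -> exists c, x = comb ws c) ->
  is_basis X (fun v => v \in ws).
Proof.
move=> wsX ind gen; split=> // [vs c Uvs vsw|x /gen[c ->]]; last by exists ws, c.
by apply: (@independent_coef id [set v | v \in ws]) => //; rewrite image_id.
Qed.

End LinearAlgebra.

Section IterLinear.
Variables (R : nzRingType) (V : lmodType R) (f : {linear V -> V}).

Lemma iter_linearD n x y : iter n f (x + y) = iter n f x + iter n f y.
Proof. by elim: n => //= n ->; rewrite linearD. Qed.

Lemma iter_linearZ n (c : R) x : iter n f (c *: x) = c *: iter n f x.
Proof. by elim: n => //= n ->; rewrite linearZ. Qed.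

Lemma iter_linear0 n : iter n f 0 = 0.
Proof. by elim: n => //= n ->; rewrite linear0. Qed.

Lemma iter_linear_sum n (I : Type) (r : seq I) (P : pred I) (F : I -> V) :
  iter n f (\sum_(i <- r | P i) F i) = \sum_(i <- r | P i) iter n f (F i).
Proof.
exact: (big_morph _ (iter_linearD n) (iter_linear0 n)).
Qed.

End IterLinear.

Lemma subspace_iter_image (R : fieldType) (V : lmodType R) (f : {linear V -> V})
    n (A : set V) : subspace A -> subspace [set y | exists x, A x /\ y = iter n f x].
Proof.
case=> A0 AD AZ; split.
- by exists 0; rewrite iter_linear0.
- move=> _ _ [x [Ax ->]] [y [Ay ->]].
  by exists (x + y); rewrite iter_linearD; split; first exact: AD.
- move=> c _ [x [Ax ->]].
  by exists (c *: x); rewrite iter_linearZ; split; first exact: AZ.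
Qed.

(** * Modules over the group ring of a cyclic group of order p in characteristic p *)

Section CyclicModule.
Variables (R : fieldType) (V : lmodType R) (s : {linear V -> V}) (p : nat).
Hypothesis pcharR : p \in [pchar R].
Hypothesis s_order : forall v, iter p s v = v.
Implicit Types (v x y : V) (P Q : {poly R}).

(* Locked so that rewriting with additivity does not match [tau v] itself. *)
Definition tau : V -> V := locked (fun v => s v - v).

Lemma tauE v : tau v = s v - v.
Proof. by rewrite /tau; unlock. Qed.

Fact tau_is_linear : linear tau.
Proof.
by move=> c x y; rewrite !tauE linearP scalerBr opprD addrACA.
Qed.

HB.instance Definition _ := GRing.isLinear.Build R V V _ tau tau_is_linear.

Lemma tauD x y : tau (x + y) = tau x + tau y.
Proof. exact: linearD. Qed.

Lemma tauZ (c : R) x : tau (c *: x) = c *: tau x.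
Proof. exact: linearZ. Qed.

Lemma tau0 : tau 0 = 0.
Proof. exact: linear0. Qed.

Lemma tau_eq0 v : tau v = 0 <-> s v = v.
Proof.
by rewrite tauE; split=> [/eqP|->]; rewrite ?subrr // subr_eq0 => /eqP.
Qed.

(** [P] evaluated at [s]: [V] becomes a module over [{poly R}] in which ['X - 1] acts as [tau], so
    divisibility of polynomials can be used. *)
Definition act P v := \sum_(i < size P) P`_i *: iter i s v.

Lemma act_widen n P v : (size P <= n)%N ->
  act P v = \sum_(i < n) P`_i *: iter i s v.
Proof.
move=> Pn; rewrite /act (big_ord_widen n (fun i => P`_i *: iter i s v)) //.
rewrite big_mkcond; apply: eq_bigr => i _; case: ltnP => // iP.
by rewrite nth_default // scale0r.
Qed.

Lemma actD P Q v : act (P + Q) v = act P v + act Q v.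
Proof.
pose n := maxn (size P) (size Q).
rewrite (@act_widen n (P + Q)) ?size_polyD // (@act_widen n P) ?leq_maxl //.
rewrite (@act_widen n Q) ?leq_maxr // -big_split; apply: eq_bigr => i _.
by rewrite coefD scalerDl.
Qed.

Lemma actN P v : act (- P) v = - act P v.
Proof.
rewrite /act size_polyN -sumrN; apply: eq_bigr => i _.
by rewrite coefN scaleNr.
Qed.

Lemma actC (c : R) v : act c%:P v = c *: v.
Proof.
by rewrite (@act_widen 1) ?size_polyC ?leq_b1 // big_ord1 coefC eqxx.
Qed.

Lemma act1 v : act 1 v = v.
Proof. by rewrite -[1]/(1%:P) actC scale1r. Qed.

Lemma actXM P v : act ('X * P) v = s (act P v).
Proof.
rewrite (@act_widen (size P).+1) ?size_mulX; last first.
  by rewrite (leq_trans (size_polyMleq _ _)) // size_polyX.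
rewrite big_ord_recl coefXM eqxx scale0r add0r linear_sum.
by apply: eq_bigr => i _; rewrite coefXM /= linearZ.
Qed.

Lemma actXn n v : act 'X^n v = iter n s v.
Proof.
elim: n => [|n IH] /=; first by rewrite expr0 act1.
by rewrite exprS actXM IH.
Qed.

Lemma act_tau n P v : act (('X - 1) ^+ n * P) v = iter n tau (act P v).
Proof.
elim: n => [|n IH] /=; first by rewrite expr0 mul1r.
by rewrite exprS -mulrA mulrBl mul1r actD actN actXM IH tauE.
Qed.

Let p_pr : prime p := pcharf_prime pcharR.
Let p_gt0 : (0 < p)%N := prime_gt0 p_pr.

Lemma polyX1_expp : ('X - 1 : {poly R}) ^+ p = 'X^p - 1.
Proof.
have pcharP : p \in [pchar {poly R}] by rewrite pchar_poly.
by rewrite -!(pFrobenius_autE pcharP) rmorphB rmorph1.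
Qed.

Lemma iter_tau_order v : iter p tau v = 0.
Proof.
have := act_tau p 1 v; rewrite mulr1 polyX1_expp actD actN actXn s_order.
by rewrite !act1 subrr => <-.
Qed.

Lemma iter_tau_ge n v : (p <= n)%N -> iter n tau v = 0.
Proof. by move=> pn; rewrite -(subnK pn) iterD iter_tau_order iter_linear0. Qed.

(** Both [('X - 1)^p] and ['X - 1] times the sum of the ['X^i], [i < p], equal ['X^p - 1]; cancel
    ['X - 1]. *)
Lemma normop_tau v : normop p s v = iter p.-1 tau v.
Proof.
have X1n0 : ('X - 1 : {poly R}) != 0 by rewrite -size_poly_eq0 size_XsubC.
have e : ('X - 1) ^+ p.-1 = \sum_(i < p) 'X^i :> {poly R}.
  by apply: (mulfI X1n0); rewrite -exprS prednK // polyX1_expp subrX1.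
have := act_tau p.-1 1 v; rewrite mulr1 act1 e => <-.
rewrite /normop; elim/big_rec2: _ => [|i P x _ ->].
  by rewrite /act size_poly0 big_ord0.
by rewrite actD actXn.
Qed.

(** [Q - Q(1)] is divisible by ['X - 1], and the norm kills the image of [tau] because
    [tau^p = 0]. *)
Lemma normop_act Q v : normop p s (act Q v) = Q.[1] *: normop p s v.
Proof.
have /factor_theorem[Q' e] : root (Q - (Q.[1])%:P) 1.
  by rewrite rootE !hornerE subrr.
rewrite -[in LHS](subrK (Q.[1])%:P Q) e mulrC !normop_tau actD actC.
rewrite -['X - _]/(('X - 1) ^+ 1) act_tau iter_linearD -iterD addn1 prednK //.
by rewrite iter_tau_order add0r iter_linearZ.
Qed.

Lemma iter_tau_normop n v : (0 < n)%N -> iter n tau (normop p s v) = 0.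
Proof.
move=> n0; rewrite normop_tau -iterD iter_tau_ge //.
by rewrite -[X in (X <= _)%N](prednK p_gt0) -add1n leq_add2r.
Qed.

Lemma normimageE : normimage p s = [set y | exists x, setT x /\ y = iter p.-1 tau x].
Proof.
apply/seteqP; split=> y [j]; first by rewrite normop_tau; exists j.
by case=> _ ->; exists j; rewrite normop_tau.
Qed.

Lemma subspace_normimage : subspace (normimage p s).
Proof. by rewrite normimageE; apply: subspace_iter_image. Qed.

Lemma submod_subspace (A : set V) : submod s A -> subspace A.
Proof. by case. Qed.

Lemma submod_iter_tau (A : set V) n x : submod s A -> A x -> A (iter n tau x).
Proof.
move=> sA Ax; elim: n => //= n; set y := iter n tau x => Ay.
rewrite tauE; have [_ _ _ As] := sA; apply: (subspaceB (submod_subspace sA) _ Ay).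
exact: As.
Qed.

(** * Generated submodules, and freeness tested on norms *)

Definition gspan (B : set V) : set V := [set y | exists (vs : seq V)
  (c : nat -> nat -> R), (forall v, v \in vs -> B v) /\ y = gcomb p s vs c].

Lemma gspan_submod B : submod s (gspan B).
Proof.
split.
- by exists [::], (fun _ _ => 0); split=> //; rewrite /gcomb big_ord0.
- move=> _ _ [vs [c [vB ->]]] [ws [d [wB ->]]].
  exists (vs ++ ws), (fun k => if (k < size vs)%N then c k else d (k - size vs)%N).
  split; first by move=> v; rewrite mem_cat => /orP[/vB|/wB].
  rewrite /gcomb size_cat big_split_ord /=; congr (_ + _).
    by apply: eq_bigr => k _; rewrite nth_cat ltn_ord.
  by apply: eq_bigr => k _; rewrite nth_cat ltnNge leq_addr /= addKn.
- move=> a _ [vs [c [vB ->]]]; exists vs, (fun k i => a * c k i); split=> //.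
  rewrite /gcomb scaler_sumr; apply: eq_bigr => k _.
  by rewrite scaler_sumr; apply: eq_bigr => i _; rewrite scalerA.
move=> _ [vs [c [vB ->]]].
(* Applying [s] rotates the coefficients: since [s^p = 1], the last one moves to index 0. *)
exists vs, (fun k i => if i is i'.+1 then c k i' else c k p.-1); split=> //.
rewrite /gcomb linear_sum; apply: eq_bigr => k _; set v := vs`_k.
have shift n : iter n s v = v -> (0 < n)%N -> s (\sum_(i < n) c k i *: iter i s v) =
    \sum_(i < n) (if val i is i'.+1 then c k i' else c k n.-1) *: iter i s v.
  case: n => // n nv _; rewrite big_ord_recr big_ord_recl /= linearD linearZ /=.
  rewrite -iterS nv addrC linear_sum; congr (_ + _).
  by apply: eq_bigr => i _; rewrite linearZ.
exact: shift.
Qed.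

Lemma sub_gspan B : B `<=` gspan B.
Proof.
move=> b Bb; exists [:: b], (fun _ i => (i == 0)%:R); split.
  by move=> v; rewrite inE => /eqP->.
rewrite /gcomb big_ord1 /= -(prednK p_gt0) big_ord_recl /= scale1r big1 ?addr0 //.
by move=> i _; rewrite scale0r.
Qed.

Lemma gspan_min B (A : set V) : submod s A -> B `<=` A -> gspan B `<=` A.
Proof.
move=> sA BA _ [vs [c [vB ->]]]; have sA' := submod_subspace sA.
apply: subspace_sum => // k _; apply: subspace_sum => // i _.
have [_ _ AZ As] := sA; apply: AZ; elim: (val i) => [|n IH]; last exact: As.
by apply/BA/vB/mem_nth.
Qed.

Lemma normop_gspan B y : gspan B y -> lspan (normop p s @` B) (normop p s y).
Proof.
move=> [vs [c [vB ->]]]; have sS := subspace_lspan (normop p s @` B).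
rewrite normop_tau iter_linear_sum; apply: subspace_sum => // k _.
have := normop_act (\poly_(i < p) c k i) vs`_k; rewrite normop_tau.
rewrite (act_widen _ (size_poly _ _)).
under eq_bigr => i _ do rewrite coef_poly ltn_ord.
move=> ->; have [_ _ SZ] := sS; apply: SZ; apply: sub_lspan.
by exists vs`_k => //; apply: vB; apply: mem_nth.
Qed.

(* Freeness can be tested after applying the norm, because the socle of a free
   module is the image of the norm. *)
Definition norm_free (B : set V) : Prop :=
  (forall b b', B b -> B b' -> normop p s b = normop p s b' -> b = b') /\
  independent (normop p s @` B).

Lemma norm_free_coef B (vs : seq V) (d : nat -> R) : norm_free B -> uniq vs ->
  (forall v, v \in vs -> B v) -> \sum_(k < size vs) d k *: normop p s vs`_k = 0 ->
  forall k, (k < size vs)%N -> d k = 0.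
Proof. by case; apply: independent_coef. Qed.

(** Induction on [l]: once [P k = ('X - 1)^l * Q k], applying [tau^(p-l-1)] to the sum gives a
    relation between norms with coefficients [(Q k).[1]]; these vanish, and another factor ['X - 1]
    splits off. *)
Lemma norm_free_divisible B (vs : seq V) (P : nat -> {poly R}) l :
  norm_free B -> uniq vs -> (forall v, v \in vs -> B v) -> (l <= p)%N ->
  iter (p - l) tau (\sum_(k < size vs) act (P k) vs`_k) = 0 ->
  exists Q : nat -> {poly R}, forall k, (k < size vs)%N ->
    P k = ('X - 1) ^+ l * Q k.
Proof.
move=> nB Uvs vB; elim: l => [|l IH] lp e.
  by exists P => k _; rewrite expr0 mul1r.
have [||Q PQ] := IH; first exact: ltnW.
  by rewrite -(subnSK lp) iterS e linear0.
have Q1 : forall k, (k < size vs)%N -> (Q k).[1] = 0.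
  apply: (norm_free_coef (d := fun k => (Q k).[1]) nB Uvs vB).
  rewrite -[RHS]e iter_linear_sum; apply: eq_bigr => k _.
  rewrite PQ // act_tau -iterD -normop_act normop_tau; congr (iter _ _ _).
  by rewrite -[in LHS](subnK lp) addnS.
exists (fun k => Q k %/ ('X - 1)) => k klt; rewrite PQ // exprSr -mulrA.
congr (_ * _); rewrite mulrC divpK // -[1]/(1%:P) dvdp_XsubCl.
by rewrite rootE Q1.
Qed.

Lemma gcombE (vs : seq V) (c : nat -> nat -> R) :
  gcomb p s vs c = \sum_(k < size vs) act (\poly_(i < p) c k i) vs`_k.
Proof.
apply: eq_bigr => k _; rewrite (act_widen _ (size_poly _ _)).
by apply: eq_bigr => i _; rewrite coef_poly ltn_ord.
Qed.

Lemma norm_free_basis B : norm_free B -> free_basis p s (gspan B) B.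
Proof.
move=> nB; split=> // [|vs c Uvs vB e k i klt ilt]; first exact: sub_gspan.
rewrite gcombE in e.
have [||Q PQ] := norm_free_divisible (P := fun k => \poly_(i < p) c k i)
  (l := p) nB Uvs vB; first by [].
  by rewrite subnn; apply: e.
(* A nonzero multiple of [('X - 1)^p = 'X^p - 1] has size above [p], while the coefficient
   polynomials have size at most [p]. *)
have := PQ k klt; have [->|Qk0] := eqVneq (Q k) 0.
  by rewrite mulr0 => /(congr1 (fun P : {poly R} => P`_i)); rewrite coef0 coef_poly ilt.
move=> /(congr1 (fun P : {poly R} => size P)) eqsz.
have := size_poly p (c k); rewrite eqsz polyX1_expp -[1]/(1%:P) mulrC.
rewrite size_Mmonic // ?monicXnsubC // size_XnsubC // addnS /=.
by rewrite -[X in (_ <= X)%N]add0n leq_add2r leqn0 size_poly_eq0 (negbTE Qk0).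
Qed.

Lemma gspan_uniq B y : gspan B y -> exists (vs : seq V) (P : nat -> {poly R}),
  [/\ uniq vs, forall v, v \in vs -> B v & y = \sum_(k < size vs) act (P k) vs`_k].
Proof.
move=> [vs [c [vB ->]]]; rewrite gcombE.
pose P k := \poly_(i < p) c k i.
exists (undup vs), (fun j => \sum_(k < size vs | vs`_k == (undup vs)`_j) P k).
split; [exact: undup_uniq | by move=> v; rewrite mem_undup => /vB |].
have -> : \sum_(j < size (undup vs))
    act (\sum_(k < size vs | vs`_k == (undup vs)`_j) P k) (undup vs)`_j =
  \sum_(v <- undup vs) \sum_(k < size vs) (if vs`_k == v then act (P k) v else 0).
  rewrite [RHS](big_nth 0) big_mkord; apply: eq_bigr => j _; rewrite -big_mkcond.
  elim/big_rec2: _ => [|k x y' _ <-]; first by rewrite /act size_poly0 big_ord0.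
  by rewrite actD.
rewrite exchange_big; apply: eq_bigr => k _.
rewrite (bigD1_seq vs`_k) ?undup_uniq ?mem_undup ?mem_nth //= eqxx big1 ?addr0 //.
by move=> v; rewrite eq_sym => /negbTE->.
Qed.

(** Divisibility with [l = p - 1]: each coefficient of a fixed element has the factor
    [('X - 1)^(p-1)], which acts as the norm. *)
Lemma norm_free_fixed B y : norm_free B -> gspan B y -> s y = y -> normimage p s y.
Proof.
move=> nB /gspan_uniq[vs [P [Uvs vB ->]]] /tau_eq0 ty.
have [||Q PQ] := norm_free_divisible (P := P) (l := p.-1) nB Uvs vB.
- exact: leq_pred.
- by rewrite -[X in (X - _)%N](prednK p_gt0) subSnn.
exists (\sum_(k < size vs) act (Q k) vs`_k).
rewrite normop_tau iter_linear_sum; apply: eq_bigr => k _.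
by rewrite PQ // act_tau.
Qed.

(** The norm has all coefficients 1, so a linear relation between norms of basis elements is a
    group-ring relation with coefficients constant in [i]. *)
Lemma free_basis_norm_free (Y B : set V) : free_basis p s Y B -> norm_free B.
Proof.
move=> [_ Bind _]; have const vs (d : nat -> R) : uniq vs ->
    (forall v, v \in vs -> B v) -> \sum_(k < size vs) d k *: normop p s vs`_k = 0 ->
    forall k, (k < size vs)%N -> d k = 0.
  move=> Uvs vB e k klt.
  apply: (Bind vs (fun k _ => d k) Uvs vB _ k 0%N klt p_gt0); rewrite -[RHS]e.
  by apply: eq_bigr => j _; rewrite /normop scaler_sumr.
split=> [b b' Bb Bb' e|_ [b Bb <-] H].
  apply: contrapT => bb'; move/eqP: (oner_neq0 R); apply.
  apply: (const [:: b; b'] (fun k => (-1) ^+ k) _ _ _ 0%N) => //=.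
  - by rewrite inE andbT; apply/eqP.
  - by move=> v; rewrite !inE => /orP[] /eqP->.
  by rewrite !big_ord_recl big_ord0 /= expr0 expr1 scale1r scaleN1r e addr0 subrr.
have : lspan (normop p s @` (B `\ b)) (normop p s b).
  apply: (lspan_mono _ H) => _ [[b' Bb' <-] bb']; exists b' => //; split=> //.
  by move=> e; apply: bb'; rewrite e.
case/lspan_image_combination=> vs [d [Uvs vB e]].
move/eqP: (oner_neq0 R); apply; apply: oppr_inj; rewrite oppr0.
apply: (const (b :: vs) (fun k => if k is k'.+1 then d vs`_k' else -1) _ _ _ 0%N) => //=.
- by rewrite Uvs andbT; apply/negP => /vB[_]; apply.
- by move=> v; rewrite inE => /orP[/eqP->//|/vB[]].
by rewrite big_ord_recl /= scaleN1r {1}e (big_nth 0) big_mkord addNr.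
Qed.

(** If the norm of some [j] were outside the span of the norms of [B], adjoining [j] to [B] would
    give a strictly larger free submodule. Hence the norm maps [B] bijectively onto a basis of the
    norm image. *)
Lemma maximal_free_same_card (W B C : set V) : maximal_free_submod p s W ->
  free_basis p s W B -> is_basis (normimage p s) C -> same_card B C.
Proof.
move=> [[sW _] Wmax] fB /(is_basis_lspan subspace_normimage)[iC NC CN].
have nB := free_basis_norm_free fB; have [BW _ Bgen] := fB.
have Wg y : W y -> gspan B y by move/Bgen.
have NB : normimage p s `<=` lspan (normop p s @` B).
  move=> _ [j ->]; apply: contrapT => nj; apply: (nj).
  have Nj' : ~ (normop p s @` B) (normop p s j) by move/sub_lspan.
  have nBj : norm_free (B `|` [set j]).
    split=> [b b' [Bb|->] [Bb'|->] // e|].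
    - by apply: (nB.1).
    - by case: Nj'; exists b.
    - by case: Nj'; exists b'.
    apply: (independent_sub _ (independent_add nB.2 nj)).
    by move=> _ [b [Bb|->] <-]; [left; exists b | right].
  apply: normop_gspan; apply: (Wg).
  apply: (Wmax (gspan (B `|` [set j]))); last by apply: sub_gspan; right.
    by split; [apply: gspan_submod | exists (B `|` [set j]); apply: norm_free_basis].
  move=> y /Wg; apply: gspan_min; first exact: gspan_submod.
  by move=> b Bb; apply: sub_gspan; left.
have [f [fC finj fsurj]] : same_card (normop p s @` B) C.
  apply: independent_same_card => //; first exact: nB.2.
    by move=> _ [b Bb <-]; apply: NC; exists b.
  by move=> c /CN /NB.
exists (f \o normop p s); split=> [b Bb|b b' Bb Bb' /finj e|c /fsurj[_ [[b Bb <-] <-]]].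
- by apply: fC; exists b.
- by apply: (nB.1) => //; apply: e; [exists b | exists b'].
by exists b.
Qed.
Lemma exists_norm_free_spanning :
  exists B, norm_free B /\ normimage p s `<=` lspan (normop p s @` B).
Proof.
have [D [DN iD ND]] := exists_independent_spanning (normimage p s).
have /choice[r rP] d : exists b, D d -> d = normop p s b.
  by have [/DN[b ->]|nd] := pselect (D d); [exists b | exists 0].
have NrD : normop p s @` (r @` D) = D.
  rewrite eqEsubset; split=> [_ [_ [d Dd <-] <-]|d Dd]; first by rewrite -rP.
  by exists (r d); [exists d | rewrite -rP].
exists (r @` D); rewrite /norm_free NrD; split=> //; split=> //.
by move=> _ _ [d Dd <-] [d' Dd' <-]; rewrite -!rP // => ->.
Qed.

Lemma free_submod_gspan B : norm_free B -> free_submod p s (gspan B).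
Proof. by move=> nB; split; [apply: gspan_submod | exists B; apply: norm_free_basis]. Qed.

(** Every nonzero submodule of [X] contains [u]: for [c] nonzero, [c] or [tau c] is a nonzero
    multiple of [u]. Two nonzero summands would thus share [u]. *)
Lemma indecomposable_of_simple_socle (X : set V) u : submod s X -> X u -> u <> 0 ->
  (forall x, X x -> tau (tau x) = 0) ->
  (forall x, X x -> tau x = 0 -> exists c : R, x = c *: u) -> indecomposable s X.
Proof.
move=> sX Xu u0 tt Xker; split=> //; first by exists u; split=> //; apply/eqP.
move=> A B sA sB XAB dAB.
have hasu C : submod s C -> C `<=` X -> (exists2 c, C c & c <> 0) -> C u.
  move=> sC CX [c Cc c0].
  have [d Cd [d0 td]] : exists2 d, C d & d <> 0 /\ tau d = 0.
    have [tc|tc] := pselect (tau c = 0); first by exists c.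
    exists (tau c); first exact: (submod_iter_tau 1 sC Cc).
    by split=> //; apply: tt; apply: CX.
  have [k dk] := Xker d (CX _ Cd) td.
  have k0 : k != 0 by apply/eqP => k0; apply: d0; rewrite dk k0 scale0r.
  by apply: (subspace_unscale (submod_subspace sC) k0); rewrite -dk.
have AX : A `<=` X.
  by move=> a Aa; apply/XAB; exists a, 0; rewrite addr0; split=> //; case: sB.
have BX : B `<=` X.
  by move=> b Bb; apply/XAB; exists 0, b; rewrite add0r; split=> //; case: sA.
have [nA|/existsNP[a /not_implyP[Aa a0]]] := pselect (forall a, A a -> a = 0).
  by left.
right=> b Bb; apply: contrapT => b0; apply: u0; apply: (dAB u (- u)).
- by apply: (hasu A sA AX); exists a.
- rewrite -scaleN1r; have [_ _ BZ _] := sB; apply: BZ.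
  by apply: (hasu B sB BX); exists b.
exact: subrr.
Qed.

(** * The decomposition, from a description of the kernel of the norm *)

Section Decomposition.
Variable alpha : V.
Hypothesis p_gt2 : (2 < p)%N.
Hypothesis tau2_alpha : tau (tau alpha) = 0.
Hypothesis norm_kernel : forall j, normop p s j = 0 ->
  exists (c : R) f w, tau f = 0 /\ j = c *: alpha + f + tau w.

(* An element of length [l < p] has norm 0, so [norm_kernel] produces one of
   length [l + 1] with the same socle; iterate up to length [p]. *)
Lemma socle_long l g : (2 < l)%N -> (l <= p)%N -> iter l tau g = 0 ->
  normimage p s (iter l.-1 tau g).
Proof.
move=> l2 lp; move: {2}(p - l)%N (erefl (p - l)%N) => n en.
elim: n l g l2 lp en => [|n IH] l g l2 lp en e.
  have -> : l = p by apply/eqP; rewrite eqn_leq lp -subn_eq0 en.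
  by exists g; rewrite normop_tau.
have ltlp : (l < p)%N by rewrite -subn_gt0 en.
have [|c [f [w [tf eg]]]] := norm_kernel (j := g).
  have le : (l <= p.-1)%N by rewrite -ltnS prednK.
  by rewrite normop_tau -(subnK le) iterD e iter_linear0.
(* [tau^2] kills both [alpha] and [f]; this is where [2 < l] enters. *)
have up m : iter m.+2 tau g = iter m.+3 tau w.
  have ttg : tau (tau g) = tau (tau (tau w)).
    by rewrite eg !tauD !tauZ tau2_alpha tf tau0 scaler0 !add0r.
  by rewrite [LHS]iterSr [LHS]iterSr ttg -!iterSr.
have [m el] : exists m, l = m.+3.
  by case: (l) l2 => [|[|[|m]]] // _; exists m.
have -> : iter l.-1 tau g = iter l tau w by rewrite el up.
apply: (IH l.+1) => //; first exact: ltnW.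
  by rewrite subnS en.
by rewrite -[RHS]e el up.
Qed.

(** Only one [tau] is applied here, so the [alpha] term survives; in the other term [w] is killed by
    [tau^3], and [p > 2] lets [socle_long] put [tau (tau w)] in the norm image. *)
Lemma socle_two g : tau (tau g) = 0 ->
  exists (c : R) w, tau g = c *: tau alpha + normop p s w.
Proof.
move=> ttg; have [|c [f [w [tf eg]]]] := norm_kernel (j := g).
  have le : (2 <= p.-1)%N by rewrite -ltnS prednK.
  by rewrite normop_tau -(subnK le) iterD /= ttg iter_linear0.
have tg : tau g = c *: tau alpha + tau (tau w).
  by rewrite eg !tauD tauZ tf addr0.
have [|v ev] := @socle_long 3 w isT p_gt2.
  by move: ttg; rewrite tg tauD tauZ tau2_alpha scaler0 add0r.
by exists c, v; rewrite tg -ev.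
Qed.

Variables (X : set V) (u : V).
Hypothesis sX : submod s X.
Hypothesis Xu : X u.
Hypothesis tau_u : tau u = 0.
Hypothesis tau2_X : forall x, X x -> tau (tau x) = 0.
Hypothesis ker_X : forall x, X x -> tau x = 0 -> exists c : R, x = c *: u.
Hypothesis u_not_norm : ~ normimage p s u.
Hypothesis alpha_X : exists x w, X x /\ tau alpha = tau x + normop p s w.

(** Spanning goes by induction on the power of [tau] that kills an element; directness is reduced to
    the kernel of [tau]. *)
Lemma decomposition : exists Y Z : set V,
  [/\ dsum3 X Y Z, free_submod p s Y,
      (forall y, (Y y /\ s y = y) <-> normimage p s y) & trivial_submod s Z].
Proof.
have [B [nB NB]] := exists_norm_free_spanning; pose Y := gspan B.
have sY : submod s Y := gspan_submod B.
have spY := submod_subspace sY; have spX := submod_subspace sX.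
have [X0 XD XZ Xs] := sX; have [Y0 YD YZ Ys] := sY.
have [N0 ND NZ] := subspace_normimage.
have NY z : normimage p s z -> exists2 y, Y y & z = iter p.-1 tau y.
  move=> /NB; suff H : lspan (normop p s @` B) z -> exists x, Y x /\ z = iter p.-1 tau x.
    by case/H=> y [Yy ->]; exists y.
  move: z; apply: lspan_min; first exact: subspace_iter_image.
  by move=> _ [b Bb <-]; exists b; rewrite normop_tau; split=> //; apply: sub_gspan.
have kerN z : normimage p s z -> tau z = 0.
  by move=> [j ->]; apply: (iter_tau_normop j (ltn0Sn 0)).
have fixY y : (Y y /\ s y = y) <-> normimage p s y.
  split=> [[Yy sy]|Ny]; first exact: norm_free_fixed nB Yy sy.
  split; last exact/tau_eq0/kerN.
  by have [y' Yy' ->] := NY y Ny; apply: submod_iter_tau.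
(* [D] is the part of [X + Y] killed by [tau], and [Z] will complement it in the kernel [A] of
   [tau]. *)
pose D := [set z | exists (c : R) w, normimage p s w /\ z = c *: u + w].
pose A := [set z | tau z = 0].
have sA : subspace A.
  split=> [|x y|c x]; rewrite /A /= ?tau0 // ?tauD ?tauZ.
    by move=> -> ->; rewrite addr0.
  by move=> ->; rewrite scaler0.
have sD : subspace D.
  split; first by exists 0, 0; rewrite scale0r addr0.
  - move=> _ _ [c [w [Nw ->]]] [c' [w' [Nw' ->]]].
    by exists (c + c'), (w + w'); rewrite scalerDl addrACA; split; first exact: ND.
  - move=> k _ [c [w [Nw ->]]].
    by exists (k * c), (k *: w); rewrite scalerDr scalerA; split; first exact: NZ.
have DA : D `<=` A.
  move=> _ [c [w [Nw ->]]]; rewrite /A /= tauD tauZ tau_u kerN //.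
  by rewrite scaler0 addr0.
have [Z [sZ ZA ZD ADZ]] := exists_complement sA sD DA.
have [Z0 ZZD ZZ] := sZ.
have uN (c : R) w : normimage p s w -> c *: u + w = 0 -> c *: u = 0 /\ w = 0.
  move=> Nw e; have [c0|c0] := eqVneq c 0.
    by move: e; rewrite c0 scale0r add0r.
  case: u_not_norm; apply: (subspace_unscale subspace_normimage c0).
  move/eqP: e; rewrite addr_eq0 => /eqP->; rewrite -scaleN1r; exact: NZ.
exists Y, Z; split=> //; last 1 first.
- split; last by move=> z /ZA /tau_eq0.
  by split=> // z Zz; have /tau_eq0-> := ZA z Zz.
- split.
    have step l j : (l <= p)%N -> iter l tau j = 0 ->
        exists x y z, [/\ X x, Y y, Z z & j = x + y + z].
      elim: l j => [|l IH] j lp ej.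
        by exists 0, 0, 0; rewrite !addr0; split=> //.
      (* It suffices to match [tau^l j] by an element of [X + Y]: the difference is killed by
         [tau^l], and the induction hypothesis applies. *)
      have red x0 y0 : X x0 -> Y y0 -> iter l tau j = iter l tau (x0 + y0) ->
          exists x y z, [/\ X x, Y y, Z z & j = x + y + z].
        move=> Xx0 Yy0 e; have [||x [y [z [Xx Yy Zz ez]]]] := IH (j - (x0 + y0)).
        - exact: ltnW.
        - by rewrite -[- _]scaleN1r iter_linearD iter_linearZ e scaleN1r subrr.
        exists (x0 + x), (y0 + y), z; split; [exact: XD | exact: YD | by [] |].
        by rewrite addrACA -[RHS]addrA -ez addrC subrK.
      have red_norm y0 : Y y0 -> iter l tau j = iter p.-1 tau y0 ->
          exists x y z, [/\ X x, Y y, Z z & j = x + y + z].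
        move=> Yy0 e; apply: (red 0 (iter (p.-1 - l) tau y0)) => //.
          exact: submod_iter_tau.
        by rewrite add0r -iterD addnC subnK // -ltnS prednK.
      (* Exponents 1, 2 and at least 3: by the complement [Z], by [socle_two] with [alpha_X]
         absorbing the error term, and by [socle_long]. *)
      case: l lp ej IH red red_norm => [|[|l]] lp ej _ red red_norm.
      + have [_ [z [[c [w [Nw ->]]] Zz ->]]] := ADZ j ej.
        exists (c *: u), w, z; split=> //; first exact: XZ.
        by have [] := (fixY w).2 Nw.
      + have [c [w ew]] := socle_two ej; have [x [w' [Xx eal]]] := alpha_X.
        have Nw' : normimage p s (c *: normop p s w' + normop p s w).
          by apply: ND; [apply: NZ; exists w' | exists w].
        have [y Yy ey] := NY _ Nw'.
        apply: (red (c *: x) (iter p.-2 tau y)); first exact: XZ.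
          exact: submod_iter_tau.
        have ->: iter 1 tau j = tau j by [].
        rewrite ew eal scalerDr -addrA ey iter_linearD /= tauZ; congr (_ + _).
        by rewrite -iterS prednK // -ltnS prednK // ltnW.
      have [y Yy ey] := NY _ (@socle_long l.+3 j isT lp ej).
      by apply: red_norm Yy ey.
    by move=> j; apply: (step p j (leqnn p)); apply: iter_tau_order.
  move=> x y z Xx Yy Zz e.
  (* Applying [tau] removes [z]; then [tau x] lies on the line of [u] and [tau y] in the norm image,
     so [uN] makes both vanish. Thus [x] and [y] lie in these two spaces themselves. *)
  have tz : tau z = 0 := ZA z Zz.
  have txy : tau x + tau y = 0.
    by move/(congr1 tau): e; rewrite !tauD tau0 /= tz addr0.
  have [c ec] := ker_X (submod_iter_tau 1 sX Xx) (tau2_X Xx).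
  have ty : normimage p s (tau y).
    apply/fixY; split; first exact: (submod_iter_tau 1 sY Yy).
    apply/tau_eq0; have -> : tau y = - tau x by apply/eqP; rewrite -addr_eq0 addrC txy.
    by rewrite -scaleN1r tauZ tau2_X // scaler0.
  have [tx0 ty0] : tau x = 0 /\ tau y = 0.
    by rewrite /= in ec; rewrite ec; apply: uN; rewrite // -ec.
  have [d ed] := ker_X Xx tx0.
  have Ny : normimage p s y by apply/fixY; split=> //; apply/tau_eq0.
  have z0 : z = 0.
    apply: ZD => //; exists (- d), (- y); split.
      by rewrite -scaleN1r; apply: NZ.
    by apply/eqP; rewrite scaleNr -ed -opprD -addr_eq0 addrC e.
  have [] := uN d y Ny; first by rewrite -ed -[RHS]e z0 addr0.
  by rewrite -ed.
exact: free_submod_gspan.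
Qed.

End Decomposition.

End CyclicModule.

(** * Kummer theory of K/F: fixed field, norm, Hilbert 90 *)

Section KummerExtension.
Variables (p : nat) (F : fieldType) (K : fieldExtType F).
Variables (xi a : F) (alpha : K) (sigma : {rmorphism K -> K}).
Hypothesis p_pr : prime p.
Hypothesis p_gt2 : (2 < p)%N.
Hypothesis p_neq0 : p%:R != 0 :> F.
Hypothesis xi_prim : p.-primitive_root xi.
Hypothesis a_neq0 : a != 0.
Hypothesis alphaX : alpha ^+ p = a%:A.
Hypothesis K_gen : <<1%VS; alpha>>%VS = fullv.
Hypothesis sigma_alg : forall c : F, sigma c%:A = c%:A.
Hypothesis sigma_alpha : sigma alpha = xi%:A * alpha.

Let p_gt0 : (0 < p)%N := prime_gt0 p_pr.

Fixpoint sigma_iter n : {rmorphism K -> K} :=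
  if n is m.+1 then sigma \o sigma_iter m else idfun.

Lemma sigma_iterE n x : iter n sigma x = sigma_iter n x.
Proof. by elim: n => //= n ->. Qed.

Lemma sigma_iter_alg n (c : F) : sigma_iter n c%:A = c%:A.
Proof. by elim: n => //= n ->. Qed.

Lemma algM (c d : F) : (c * d)%:A = c%:A * d%:A :> K.
Proof. exact: (rmorphM (in_alg K)). Qed.

Lemma algX (c : F) n : (c ^+ n)%:A = c%:A ^+ n :> K.
Proof. exact: (rmorphXn (in_alg K)). Qed.

Lemma alg_eq0 (c : F) : (c%:A == 0 :> K) = (c == 0).
Proof. by rewrite scaler_eq0 oner_eq0 orbF. Qed.

Lemma alg_natr n : (n%:R)%:A = n%:R :> K.
Proof. exact: (rmorph_nat (in_alg K)). Qed.

Lemma alpha_neq0 : alpha != 0.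
Proof.
apply/eqP => a0; move: alphaX; rewrite a0 expr0n gtn_eqF // => /eqP.
by rewrite eq_sym alg_eq0 (negbTE a_neq0).
Qed.

Lemma xi_neq0 : xi != 0.
Proof.
apply/eqP => x0; have := prim_expr_order xi_prim.
by move/eqP; rewrite x0 expr0n gtn_eqF // eq_sym oner_eq0.
Qed.

Lemma sigma_iter_alpha n : sigma_iter n alpha = (xi ^+ n)%:A * alpha.
Proof.
elim: n => [|n /= ->]; first by rewrite expr0 scale1r mul1r.
by rewrite rmorphM sigma_alg sigma_alpha mulrA exprSr algM.
Qed.

(** Orthogonality of characters: the geometric sum is killed by [xi^n - 1], which is nonzero unless
    [p] divides [n]. *)
Lemma sum_xi n : \sum_(i < p) (xi ^+ n) ^+ i = if (p %| n)%N then p%:R else 0.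
Proof.
rewrite (prim_order_dvd xi_prim); case: eqP => [->|/eqP xn].
  by under eq_bigr => i _ do rewrite expr1n; rewrite sumr_const card_ord.
have : (xi ^+ n - 1) * \sum_(i < p) (xi ^+ n) ^+ i = 0.
  by rewrite -subrX1 exprAC (prim_expr_order xi_prim) expr1n subrr.
by move/eqP; rewrite mulf_eq0 subr_eq0 (negbTE xn) => /eqP.
Qed.

Lemma alpha_expansion x :
  exists n (f : nat -> F), x = \sum_(j < n) (f j)%:A * alpha ^+ j.
Proof.
have : x \in <<1%VS; alpha>>%VS by rewrite K_gen memvf.
case/Fadjoin_polyP=> _ /polyOver1P[P ->] ->.
exists (size P), (fun j => P`_j); rewrite horner_coef size_map_poly.
by apply: eq_bigr => j _; rewrite coef_map.
Qed.

Lemma sigma_iter_expansion i n (f : nat -> F) :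
  sigma_iter i (\sum_(j < n) (f j)%:A * alpha ^+ j) =
  \sum_(j < n) (f j)%:A * alpha ^+ j * ((xi ^+ j) ^+ i)%:A.
Proof.
rewrite rmorph_sum; apply: eq_bigr => j _.
rewrite rmorphM sigma_iter_alg rmorphXn sigma_iter_alpha exprMn -algX -mulrA.
by rewrite [alpha ^+ _ * _]mulrC exprAC.
Qed.

Lemma sigma_order x : iter p sigma x = x.
Proof.
rewrite sigma_iterE; have [n [f ->]] := alpha_expansion x.
rewrite sigma_iter_expansion; apply: eq_bigr => j _.
by rewrite exprAC (prim_expr_order xi_prim) expr1n scale1r mulr1.
Qed.

(** Averaging over G: [p x] is the sum of the conjugates of [x], and by [sum_xi] only the [alpha^j]
    with [p] dividing [j] survive; these are powers of [a]. *)
Lemma sigma_fixed x : sigma x = x -> exists c : F, x = c%:A.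
Proof.
move=> sx; have [n [f ex]] := alpha_expansion x.
have pK : p%:R != 0 :> K by rewrite -alg_natr alg_eq0.
exists (\sum_(j < n) if (p %| j)%N then f j * a ^+ (j %/ p) else 0).
apply: (mulfI pK); transitivity (\sum_(i < p) sigma_iter i x).
  rewrite -[p in p%:R]card_ord -sumr_const mulr_suml; apply: eq_bigr => i _.
  by rewrite mul1r; elim: (val i) => //= m <-; rewrite sx.
rewrite {1}ex; under [LHS]eq_bigr => i _ do rewrite sigma_iter_expansion.
rewrite exchange_big scaler_suml mulr_sumr; apply: eq_bigr => j _ /=.
rewrite -mulr_sumr -scaler_suml sum_xi; case: ifP => [/dvdnP[m ej]|_]; last first.
  by rewrite !scale0r !mulr0.
rewrite algM alg_natr [RHS]mulrC; congr (_ * _ * _).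
by rewrite ej mulnK // algX -alphaX -exprM mulnC.
Qed.

Definition Nm (x : K) : K := \prod_(i < p) iter i sigma x.

Lemma NmE x : Nm x = \prod_(i < p) sigma_iter i x.
Proof. by apply: eq_bigr => i _; rewrite sigma_iterE. Qed.

Lemma NmM x y : Nm (x * y) = Nm x * Nm y.
Proof. by rewrite !NmE -big_split; apply: eq_bigr => i _; rewrite rmorphM. Qed.

Lemma Nm1 : Nm 1 = 1.
Proof. by rewrite NmE big1 // => i _; rewrite rmorph1. Qed.

Lemma NmX x n : Nm (x ^+ n) = Nm x ^+ n.
Proof. by elim: n => [|n IH]; rewrite ?expr0 ?Nm1 // !exprS NmM IH. Qed.

Lemma Nm_alg (c : F) : Nm c%:A = c%:A ^+ p.
Proof.
rewrite NmE; under eq_bigr => i _ do rewrite sigma_iter_alg.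
by rewrite prodr_const card_ord.
Qed.

Lemma Nm_neq0 x : x != 0 -> Nm x != 0.
Proof.
by move=> x0; rewrite NmE; apply/prodf_neq0 => i _; rewrite fmorph_eq0.
Qed.

Lemma NmV x : Nm x^-1 = (Nm x)^-1.
Proof. by rewrite !NmE -prodfV; apply: eq_bigr => i _; rewrite fmorphV. Qed.

Lemma sigma_Nm x : sigma (Nm x) = Nm x.
Proof.
rewrite NmE rmorph_prod; case: p p_gt0 (sigma_order x) => // n _ ex.
rewrite big_ord_recr [RHS]big_ord_recl /= mulrC; congr (_ * _).
by rewrite -sigma_iterE -iterS ex.
Qed.

Lemma Nm_sigma x : Nm (sigma x) = Nm x.
Proof.
rewrite -[RHS]sigma_Nm rmorph_prod; apply: eq_bigr => i _.
by rewrite -iterSr.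
Qed.

Lemma Nm_in_base x : exists c : F, Nm x = c%:A.
Proof. exact: sigma_fixed (sigma_Nm x). Qed.

(** The roots of unity multiply to [xi] to the power ['C(p, 2)], which [p] divides since [p] is
    odd. *)
Lemma Nm_alpha : Nm alpha = alpha ^+ p.
Proof.
rewrite NmE; under eq_bigr => i _ do rewrite sigma_iter_alpha.
rewrite big_split /= prodr_const card_ord -(rmorph_prod (in_alg K)) /=.
rewrite prodrXr -(big_mkord predT id) bin2_sum.
have /dvdnP[m ->] := prime_dvd_bin p_pr (p_gt2 : 0 < 2 < p)%N.
by rewrite mulnC exprM (prim_expr_order xi_prim) expr1n scale1r mul1r.
Qed.

(** The resolvent [w u], weighted by the partial norms [C i] of [c], satisfies
    [c * sigma (w u) = w u]; the inverse of a nonzero resolvent is the witness. *)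
Lemma Hilbert90 c : Nm c = 1 -> exists w, w != 0 /\ c = sigma w / w.
Proof.
move=> Nc; pose C n := \prod_(k < n) sigma_iter k c.
have C0 : C 0%N = 1 by rewrite /C big_ord0.
have Cp : C p = 1 by rewrite -[LHS]NmE.
have CS n : C n.+1 = c * sigma (C n).
  by rewrite /C big_ord_recl rmorph_prod.
pose w u := \sum_(i < p) C i * sigma_iter i u.
have cw u : c * sigma (w u) = w u.
  have e n : c * sigma (\sum_(i < n) C i * sigma_iter i u) =
      \sum_(i < n) C i.+1 * sigma_iter i.+1 u.
    rewrite rmorph_sum mulr_sumr; apply: eq_bigr => i _.
    by rewrite rmorphM mulrA -CS.
  have ep : C p * sigma_iter p u = C 0%N * sigma_iter 0 u.
    by rewrite Cp C0 -sigma_iterE sigma_order.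
  rewrite /w e; case: p p_gt0 ep => // n _ ep.
  by rewrite big_ord_recr [RHS]big_ord_recl /= -ep addrC.
(* If [w] vanished on every power of [alpha], the sum over [i] of [C i * xi^(i j)] would be 0 for
   all [j]; adding these over [j < p] leaves [p * C 0 = p]. *)
have [j wj] : exists j, w (alpha ^+ j) != 0.
  apply: contrapT => /forallNP wz; move/eqP: p_neq0; apply; apply/eqP.
  rewrite -alg_eq0 alg_natr.
  have -> : p%:R = \sum_(i < p) C i * (\sum_(j < p) (xi ^+ i) ^+ j)%:A.
    under [RHS]eq_bigr => i _ do rewrite sum_xi.
    rewrite -(prednK p_gt0) big_ord_recl /= (prednK p_gt0) alg_natr C0 mul1r.
    rewrite big1 ?addr0 //.
    move=> i _; rewrite gtnNdvd ?scale0r ?mulr0 // /bump /=.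
    by rewrite add1n -[X in (_ < X)%N](prednK p_gt0) ltnS.
  under eq_bigr => i _ do rewrite scaler_suml mulr_sumr.
  rewrite exchange_big big1 // => j _.
  have ajn0 : alpha ^+ j != 0 by rewrite expf_neq0 // alpha_neq0.
  apply/eqP; rewrite -(mulIr_eq0 _ (mulIf ajn0)) mulr_suml.
  have /negP := wz j; rewrite negbK => /eqP; rewrite /w => wj0; apply/eqP.
  rewrite -[RHS]wj0; apply: eq_bigr => i _.
  by rewrite rmorphXn sigma_iter_alpha exprMn -algX mulrA.
exists (w (alpha ^+ j))^-1; rewrite invr_eq0; split=> //.
rewrite fmorphV invrK -[X in _ = _ * X]cw mulrCA mulVf ?mulr1 //.
by rewrite fmorph_eq0.
Qed.

Lemma unity_root_xi (x : K) : x ^+ p = 1 -> exists t, x = (xi ^+ t)%:A :> K.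
Proof.
move=> xp; have xiK : p.-primitive_root (xi%:A : K).
  by rewrite -[_%:A]/(in_alg K xi) fmorph_primitive_root.
by have [t ->] := prim_rootP xiK xp; exists t; rewrite algX.
Qed.

(** [sigma y / y] is a pth root of unity [xi^t]; [alpha^t] has the same quotient, so [y / alpha^t]
    is fixed by [sigma]. *)
Lemma pth_root_in_base y (c : F) : y != 0 -> y ^+ p = c%:A ->
  exists t (f : F), f != 0 /\ y = alpha ^+ t * f%:A.
Proof.
move=> y0 yp; have [|t et] := unity_root_xi (x := sigma y / y).
  by rewrite expr_div_n -rmorphXn yp sigma_alg divff // -yp expf_neq0.
have at0 : alpha ^+ t != 0 by rewrite expf_neq0 // alpha_neq0.
have [|f ef] := @sigma_fixed (y / alpha ^+ t).
  rewrite fmorph_div rmorphXn sigma_alpha exprMn -algX -et.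
  have sy0 : sigma y != 0 by rewrite fmorph_eq0.
  by rewrite invfM invf_div mulrA [sigma y * _]mulrC divfK.
exists t, f; split; last by rewrite -ef mulrC divfK.
by rewrite -alg_eq0 -ef mulf_neq0 // invr_eq0.
Qed.

(** Together with [pth_root_in_base], this makes a nonzero pth power lying in F the norm of its
    root. *)
Lemma Nm_alpha_alg t (f : F) : Nm (alpha ^+ t * f%:A) = (alpha ^+ t * f%:A) ^+ p.
Proof. by rewrite NmM NmX Nm_alpha Nm_alg exprMn exprAC. Qed.

(** * Power classes of K as a module over the group ring *)

Section PowerClasses.
Variables (J : lmodType 'F_p) (q : K -> J) (s : {linear J -> J}).
Hypothesis qM : forall x y : K, x != 0 -> y != 0 -> q (x * y) = q x + q y.
Hypothesis q_surj : forall j : J, exists x : K, x != 0 /\ q x = j.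
Hypothesis q_ker : forall x : K, x != 0 -> (q x = 0 <-> exists y : K, x = y ^+ p).
Hypothesis s_q : forall x : K, x != 0 -> s (q x) = q (sigma x).

Lemma q1 : q 1 = 0.
Proof. by apply/q_ker; [apply: oner_neq0 | exists 1; rewrite expr1n]. Qed.

Lemma qV x : x != 0 -> q x^-1 = - q x.
Proof.
move=> x0; apply/eqP; rewrite -addr_eq0 -qM ?invr_eq0 //.
by rewrite mulVf // q1.
Qed.

Lemma qX x n : x != 0 -> q (x ^+ n) = n%:R *: q x.
Proof.
move=> x0; elim: n => [|n IH]; first by rewrite expr0 q1 scale0r.
by rewrite exprS qM ?expf_neq0 // IH !scaler_nat mulrS.
Qed.

Lemma iter_s_q n x : x != 0 -> iter n s (q x) = q (iter n sigma x).
Proof.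
by move=> x0; elim: n => //= n ->; rewrite s_q // sigma_iterE fmorph_eq0.
Qed.

Lemma s_orderJ j : iter p s j = j.
Proof. by have [x [x0 <-]] := q_surj j; rewrite iter_s_q // sigma_order. Qed.

Lemma tau_q x : x != 0 -> tau s (q x) = q (sigma x / x).
Proof.
by move=> x0; rewrite tauE s_q // qM ?invr_eq0 ?fmorph_eq0 // qV.
Qed.

Lemma normop_q x : x != 0 -> normop p s (q x) = q (Nm x).
Proof.
move=> x0; rewrite /normop /Nm; suff [_ ->] : \prod_(i < p) iter i sigma x != 0 /\
  q (\prod_(i < p) iter i sigma x) = \sum_(i < p) iter i s (q x) by [].
elim/big_rec2: _ => [|i y z _ [z0 ez]]; first by rewrite oner_neq0 q1.
have i0 : iter i sigma x != 0 by rewrite sigma_iterE fmorph_eq0.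
by rewrite mulf_neq0 // qM // ez iter_s_q.
Qed.

Lemma q_eq x y : x != 0 -> y != 0 -> q x = q y -> exists2 c, c != 0 & x = y * c ^+ p.
Proof.
move=> x0 y0 e; have xy0 : x / y != 0 by rewrite mulf_neq0 ?invr_eq0.
have [|c ec] := (q_ker xy0).1; first by rewrite qM ?invr_eq0 // qV // e subrr.
exists c; last by rewrite -ec mulrC divfK.
by apply: contraNneq xy0 => c0; rewrite ec c0 expr0n gtn_eqF.
Qed.

Let pcharFp : p \in [pchar 'F_p] := pchar_Fp p_pr.

Lemma normop_kernel j : normop p s j = 0 ->
  exists (c : 'F_p) f w, tau s f = 0 /\ j = c *: q alpha + f + tau s w.
Proof.
have [x [x0 <-]] := q_surj j; rewrite normop_q // => e.
have [y ey] := (q_ker (Nm_neq0 x0)).1 e; have [c ec] := Nm_in_base x.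
have y0 : y != 0.
  by apply: contraNneq (Nm_neq0 x0) => y0; rewrite ey y0 expr0n gtn_eqF.
have [|t [f [f0 ety]]] := pth_root_in_base y0 (c := c); first by rewrite -ey.
(* As [y] has the form [alpha^t f], its norm is [y^p], which is the norm of [x]. *)
have [|w [w0 ew]] := @Hilbert90 (x / y).
  by rewrite NmM NmV ety Nm_alpha_alg -ety -ey divff // Nm_neq0.
have fA0 : f%:A != 0 :> K by rewrite alg_eq0.
have at0 : alpha ^+ t != 0 by rewrite expf_neq0 // alpha_neq0.
exists t%:R, (q f%:A), (q w); split.
  by rewrite tau_q // sigma_alg divff // q1.
rewrite tau_q // -ew -qX ?alpha_neq0 // -qM // -ety -qM //; last first.
  by rewrite mulf_neq0 ?invr_eq0.
by rewrite mulrC divfK.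
Qed.

Lemma tau_q_alpha : tau s (q alpha) = q xi%:A.
Proof. by rewrite tau_q ?alpha_neq0 // sigma_alpha mulfK // alpha_neq0. Qed.

Lemma tau_q_alg (c : F) : c != 0 -> tau s (q c%:A) = 0.
Proof. by move=> c0; rewrite tau_q ?alg_eq0 // sigma_alg divff ?alg_eq0 // q1. Qed.

(** If [xi = Nm x * c^p], then [c^p] lies in F, so it is the norm of [c] and [xi = Nm (x * c)]. *)
Lemma q_xi_norm : normimage p s (q xi%:A) -> exists k, k != 0 /\ Nm k = xi%:A.
Proof.
have xi0 : xi%:A != 0 :> K by rewrite alg_eq0 xi_neq0.
move=> [j]; have [x [x0 <-]] := q_surj j; rewrite normop_q // => e.
have Nx0 := Nm_neq0 x0; have [c c0 ec] := q_eq xi0 Nx0 e.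
have [d ed] := Nm_in_base x.
have [|t [f [f0 et]]] := pth_root_in_base c0 (c := xi / d).
  have d0 : d%:A != 0 :> K by rewrite -ed.
  by apply: (mulfI Nx0); rewrite -ec ed -algM mulrC divfK // -alg_eq0.
exists (x * c); rewrite mulf_neq0 //; split=> //.
by rewrite NmM et Nm_alpha_alg -et.
Qed.

(* [k ^+ p] has norm 1, hence equals [sigma d / d], and [q d] is fixed without
   coming from the base field. *)
Lemma fixed_not_norm k : Nm k = xi%:A ->
  exists d, tau s d = 0 /\ ~ normimage p s d.
Proof.
move=> Nk; have xip : xi%:A ^+ p = 1 :> K.
  by rewrite -algX (prim_expr_order xi_prim) scale1r.
have [|d [d0 ed]] := @Hilbert90 (k ^+ p); first by rewrite NmX Nk.
exists (q d); split.
  rewrite tau_q // -ed; apply/q_ker; last by exists k.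
  by rewrite ed mulf_neq0 ?invr_eq0 ?fmorph_eq0.
move=> [j]; have [x [x0 <-]] := q_surj j; rewrite normop_q // => e.
have Nx0 := Nm_neq0 x0; have [c c0 ec] := q_eq d0 Nx0 e.
(* If [d = Nm x * c^p], then [sigma d / d = (sigma c / c)^p], because [sigma] fixes [Nm x]. So [k]
   is [sigma c / c] times a power of [xi], and has norm 1 instead of [xi]. *)
have kp : k ^+ p = (sigma c / c) ^+ p.
  rewrite ed ec rmorphM sigma_Nm rmorphXn expr_div_n invfM mulrACA.
  by rewrite divff // mul1r.
have sc0 : sigma c / c != 0 by rewrite mulf_neq0 ?invr_eq0 ?fmorph_eq0.
have [|t et] := unity_root_xi (x := k / (sigma c / c)).
  by rewrite expr_div_n kp divff // expf_neq0.
have Nk1 : Nm k = 1.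
  rewrite -(divfK sc0 k) et NmM Nm_alg NmM NmV Nm_sigma divff ?Nm_neq0 // mulr1.
  by rewrite -algX exprAC (prim_expr_order xi_prim) expr1n scale1r.
have /eqP : (xi - 1)%:A = 0 :> K by rewrite scalerBl scale1r -Nk Nk1 subrr.
rewrite alg_eq0 subr_eq0 -(expr1 xi) -(prim_order_dvd xi_prim) dvdn1 => /eqP p1.
by move: p_pr; rewrite p1.
Qed.

Let exists_norm := exists k : K, k != 0 /\ Nm k = xi%:A.

Lemma exists_exceptional_summand : exists (X : set J) (u : J),
  [/\ submod s X, X u & [/\ tau s u = 0, forall x, X x -> tau s (tau s x) = 0,
      forall x, X x -> tau s x = 0 -> exists c : 'F_p, x = c *: u,
      ~ normimage p s u &
      exists x w, X x /\ tau s (q alpha) = tau s x + normop p s w]] /\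
  (exists_norm -> dim_eq X 1) /\ (~ exists_norm -> dim_eq X 2).
Proof.
have [N0 ND NZ] := subspace_normimage s pcharFp.
have neq0 u : ~ normimage p s u -> u != 0.
  by move=> nu; apply/eqP => u0; apply: nu; rewrite u0.
have [nk|nk] := pselect exists_norm.
  have [k [k0 Nk]] := nk; have [d [td nd]] := fixed_not_norm Nk.
  pose X := [set x | exists c : 'F_p, x = c *: d].
  have Xd : X d by exists 1; rewrite scale1r.
  have Xt x : X x -> tau s x = 0 by move=> [c ->]; rewrite tauZ td scaler0.
  exists X, d; split; last first.
    split=> // _; exists [:: d]; split=> //; apply: is_basis_seq.
    - by move=> v; rewrite inE => /eqP->.
    - apply: independent_sub (independent_set1 (neq0 d nd)).
      by move=> v /=; rewrite inE => /eqP->.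
    by move=> _ [c ->]; exists (fun=> c); rewrite /comb big_ord1.
  split=> //; first split.
  - by exists 0; rewrite scale0r.
  - by move=> _ _ [c ->] [c' ->]; exists (c + c'); rewrite scalerDl.
  - by move=> c _ [c' ->]; exists (c * c'); rewrite scalerA.
  - by move=> x Xx; have /tau_eq0-> := Xt x Xx.
  split=> // [x /Xt->|]; first exact: tau0.
  (* Here [tau (q alpha)], the class of [xi], is itself the norm of [q k], so [x = 0] works. *)
  exists 0, (q k); split; first by exists 0; rewrite scale0r.
  by rewrite tau0 add0r tau_q_alpha normop_q // Nk.
set e := q xi%:A; have ne : ~ normimage p s e by move/q_xi_norm.
have e0 := neq0 e ne; have te : tau s e = 0 by apply: tau_q_alg xi_neq0.
(* A Jordan block of size 2: [tau] sends [q alpha] to [e] and kills [e]. *)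
pose X := [set x | exists c d : 'F_p, x = c *: q alpha + d *: e].
have tX (c d : 'F_p) : tau s (c *: q alpha + d *: e) = c *: e.
  by rewrite tauD !tauZ te scaler0 addr0 tau_q_alpha.
have sX : subspace X.
  split.
  - by exists 0, 0; rewrite !scale0r addr0.
  - move=> _ _ [c [d ->]] [c' [d' ->]].
    by exists (c + c'), (d + d'); rewrite !scalerDl addrACA.
  - move=> k _ [c [d ->]]; exists (k * c), (k * d).
    by rewrite scalerDr !scalerA.
have Xe : X e by exists 0, 1; rewrite scale0r add0r scale1r.
have Xa : X (q alpha) by exists 1, 0; rewrite scale0r addr0 scale1r.
have ce0 (c : 'F_p) : c *: e = 0 -> c = 0.
  by move/eqP; rewrite scaler_eq0 (negbTE e0) orbF => /eqP.
exists X, e; split; last first.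
  split=> // _; exists [:: q alpha; e]; split=> //.
    rewrite /= inE andbT; apply/eqP => ae; move/eqP: e0; apply.
    by rewrite -te -ae tau_q_alpha.
  apply: is_basis_seq.
  - by move=> v; rewrite !inE => /orP[] /eqP->.
  - apply: (independent_sub _ (independent_add (independent_set1 e0) (c := q alpha) _)).
      by move=> v /=; rewrite !inE => /orP[] /eqP->; [right | left].
    (* If [q alpha] were in the span of [e], [tau] would kill it, yet its image under [tau] is
       [e]. *)
    move=> H; move/eqP: e0; apply; rewrite /e -tau_q_alpha.
    apply: (H [set x | tau s x = 0]); last by move=> x ->.
    split=> [|x y|c x] /=; rewrite ?tau0 ?tauD ?tauZ //.
      by move=> -> ->; rewrite addr0.
    by move=> ->; rewrite scaler0.
  move=> _ [c [d ->]]; exists (fun k => if k is 0%N then c else d).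
  by rewrite /comb !big_ord_recl big_ord0 /= addr0.
split=> //.
  have [X0 XD XZ] := sX; split=> // x Xx.
  rewrite -(subrK x (s x)) -tauE; apply: XD => //.
  by case: Xx => c [d ->]; rewrite tX; apply: XZ.
split=> // [_ [c [d ->]]|_ [c [d ->]]|].
- by rewrite tX tauZ te scaler0.
- by rewrite tX => /ce0->; exists d; rewrite scale0r add0r.
exists (q alpha), 0; split=> //.
by rewrite normop_tau ?iter_linear0 ?addr0 //; apply: s_orderJ.
Qed.

End PowerClasses.

End KummerExtension.

(* The decomposition of J for the extension K/F *)
Local Close Scope classical_set_scope.

(** Equality of rank and dimension is expressed by a bijection of bases, which is meaningful in
    infinite dimension as well. *)
Theorem theorem1 (p : nat) (F : fieldType) (K : fieldExtType F)
    (xi a : F) (alpha : K) (sigma : {rmorphism K -> K})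
    (J : lmodType 'F_p) (q : K -> J) (s : J -> J) :
  prime p -> (2 < p)%N ->
  p%:R != 0 :> F ->
  p.-primitive_root xi ->
  ~ (exists b : F, b ^+ p = a) ->
  alpha ^+ p = a%:A ->
  <<1%VS; alpha>>%VS = fullv ->
  (forall c : F, sigma c%:A = c%:A) ->
  sigma alpha = xi%:A * alpha ->
  (* J = K^x / K^x^p, presented by the quotient map q *)
  (forall x y : K, x != 0 -> y != 0 -> q (x * y) = q x + q y) ->
  (forall j : J, exists x : K, x != 0 /\ q x = j) ->
  (forall x : K, x != 0 -> (q x = 0 <-> exists y : K, x = y ^+ p)) ->
  (* s is the action of sigma on J *)
  (forall x : K, x != 0 -> s (q x) = q (sigma x)) ->
  (exists X Y Z : J -> Prop,
     [/\ dsum3 X Y Z,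
         indecomposable s X /\
         ((exists k : K, k != 0 /\ \prod_(i < p) iter i sigma k = xi%:A) -> dim_eq X 1) /\
         (~ (exists k : K, k != 0 /\ \prod_(i < p) iter i sigma k = xi%:A) -> dim_eq X 2),
         free_submod p s Y,
         (forall y, (Y y /\ s y = y) <-> normimage p s y)
       & trivial_submod s Z]) /\
  (forall W : J -> Prop, maximal_free_submod p s W ->
     forall B C : J -> Prop, free_basis p s W B -> is_basis (normimage p s) C ->
       same_card B C).
Proof.
move=> p_pr p_gt2 p_neq0 xi_prim a_nopow alphaX K_gen sigma_alg sigma_alpha.
move=> qM q_surj q_ker s_q.
have a_neq0 : a != 0.
  by apply/eqP => a0; apply: a_nopow; exists 0; rewrite expr0n gtn_eqF ?prime_gt0.
have sD : {morph s : x y / x + y}.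
  move=> i j; have [x [x0 <-]] := q_surj i; have [y [y0 <-]] := q_surj j.
  by rewrite -qM // !s_q ?mulf_neq0 // rmorphM qM ?fmorph_eq0.
have s0 : s 0 = 0 by apply: (addrI (s 0)); rewrite -sD !addr0.
have s_lin : linear s.
  (* Scalars of ['F_p] are classes of natural numbers, so additivity gives linearity. *)
  move=> c x y; rewrite sD; congr (_ + _); rewrite -[c]natr_Zp !scaler_nat.
  by elim: (val c) => [|n IH]; rewrite ?mulr0n // !mulrS sD IH.
pose sl : {linear J -> J} := HB.pack s (GRing.isLinear.Build 'F_p J J _ s s_lin).
have pcharFp := pchar_Fp p_pr.
have sl_q : forall x : K, x != 0 -> sl (q x) = q (sigma x) := s_q.
have s_order : forall j, iter p sl j = j.
  exact: (s_orderJ xi_prim K_gen sigma_alg sigma_alpha q_surj sl_q).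
split; last by move=> W maxW B C; apply: (maximal_free_same_card (s := sl)).
have [X [u [[sX Xu [tu ttX kerX nu aX]] dimX]]] :=
  @exists_exceptional_summand p F K xi a alpha sigma p_pr p_gt2 p_neq0 xi_prim
    a_neq0 alphaX K_gen sigma_alg sigma_alpha J q sl qM q_surj q_ker sl_q.
have ta : tau sl (tau sl (q alpha)) = 0.
  rewrite (tau_q_alpha p_pr a_neq0 alphaX sigma_alpha qM q_ker sl_q).
  exact: (tau_q_alg sigma_alg qM q_ker sl_q (xi_neq0 p_pr xi_prim)).
have u0 : u <> 0.
  have [N0 _ _] := subspace_normimage sl pcharFp.
  by move=> e; apply: nu; rewrite e.
have [|Y [Z [dXYZ fY fixY tZ]]] :=
  decomposition pcharFp s_order p_gt2 ta _ sX Xu tu ttX kerX nu aX.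
  exact: (normop_kernel p_pr p_gt2 p_neq0 xi_prim a_neq0 alphaX K_gen sigma_alg
    sigma_alpha qM q_surj q_ker sl_q).
exists X, Y, Z; split=> //; split=> //.
exact: (indecomposable_of_simple_socle (s := sl) sX Xu u0 ttX kerX).
Qed.
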